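(* Let $A,B\in\mathfrak{T}(\mathbb{R})$. If $A$ and $B$ are $OT$-positive, then $A+B$ is also $OT$-positive.
   Context: A triangular fuzzy number (TFN) is identified with a triple $(a,b,c)\in\mathbb{R}^3$ with $a\leq b\leq c$; $\mathfrak{T}(\mathbb{R})$ is the set of all TFNs. For $r\in\mathbb{R}$, $\widetilde{r}=(r,r,r)$ is the crisp fuzzy number at $r$. Addition is $(a_1,b_1,c_1)+(a_2,b_2,c_2)=(a_1+a_2,b_1+b_2,c_1+c_2)$. $(a_1,b_1,c_1)\leq_{OT}(a_2,b_2,c_2)$ if and only if $b_1<b_2$; or $b_1=b_2$ and $c_1<c_2$; or $b_1=b_2$, $c_1=c_2$ and $a_1\leq a_2$. Write $A<_{OT}B$ (equivalently $B>_{OT}A$) when $A\leq_{OT}B$ and $A\neq B$. $A$ is $OT$-positive if $A>_{OT}\widetilde{0}$. *)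

(* Defs.v *)
From mathcomp Require Import all_boot all_order all_algebra.
From mathcomp Require Import reals.

Set Implicit Arguments.
Unset Strict Implicit.
Unset Printing Implicit Defensive.

Import Order.TTheory GRing.Theory Num.Theory.
Local Open Scope ring_scope.

(* Since [tfnP] is a boolean proposition, its proofs are irrelevant, so
   Leibniz equality on [tfn R] is equality of the underlying triples. *)
Record tfn (R : realType) := TFN {
  tfn_a : R;
  tfn_b : R;
  tfn_c : R;
  tfnP : tfn_a <= tfn_b <= tfn_c
}.

Lemma crisp_subproof (R : realType) (r : R) : r <= r <= r.
Proof. by rewrite lexx. Qed.

Definition crisp (R : realType) (r : R) : tfn R := TFN (crisp_subproof r).

Lemma tfn_add_subproof (R : realType) (A B : tfn R) :
  tfn_a A + tfn_a B <= tfn_b A + tfn_b B <= tfn_c A + tfn_c B.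
Proof.
by have /andP[? ?] := tfnP A; have /andP[? ?] := tfnP B; rewrite !lerD.
Qed.

Definition tfn_add (R : realType) (A B : tfn R) : tfn R :=
  TFN (tfn_add_subproof A B).

Definition le_OT (R : realType) (A B : tfn R) : Prop :=
  [\/ tfn_b A < tfn_b B,
      tfn_b A = tfn_b B /\ tfn_c A < tfn_c B
    | [/\ tfn_b A = tfn_b B, tfn_c A = tfn_c B & tfn_a A <= tfn_a B]].

Definition lt_OT (R : realType) (A B : tfn R) : Prop :=
  le_OT A B /\ A <> B.

Definition OT_positive (R : realType) (A : tfn R) : Prop :=
  lt_OT (crisp 0) A.

(* Main.v *)
(* Since [a <= b <= c], a TFN is OT-positive exactly when [0 <= b] and [0 < c]:
   the tie-break on [a] never applies, because [b = c = 0] and [0 <= a] force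
   the TFN to be the crisp zero.  Both conditions are stable under addition. *)
Require Import Defs.
From mathcomp Require Import all_boot all_order all_algebra.
From mathcomp Require Import reals.

Import Order.TTheory GRing.Theory Num.Theory.
Local Open Scope ring_scope.

(** Reduces equality with the crisp zero to three equations in [R], so that the disequality in
    [lt_OT] can be refuted. *)
Lemma tfn_inj (R : realType) (A B : tfn R) :
  tfn_a A = tfn_a B -> tfn_b A = tfn_b B -> tfn_c A = tfn_c B -> A = B.
Proof.
case: A B => [a b c p] [a' b' c' q] /= ea eb ec.
by subst; rewrite (bool_irrelevance p q).
Qed.

Lemma OT_positiveP (R : realType) (A : tfn R) :
  OT_positive A <-> 0 <= tfn_b A /\ 0 < tfn_c A.
Proof.
have /andP[ab bc] := tfnP A; split.
  case=> -[/= b_gt0|[/= <- //]|[/= b0 c0 a_ge0]] neq.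
    by split; [exact: ltW | exact: lt_le_trans bc].
  case: neq; apply: tfn_inj => //=.
  (* Only [0 = tfn_a A] remains; rewriting [0] into [tfn_b A] turns the missing bound [tfn_a A <= 0]
     into [ab]. *)
  by apply/eqP; rewrite eq_le a_ge0 b0.
case=> b_ge0 c_gt0; split; last first.
  by move=> A0; move: c_gt0; rewrite -A0 /= ltxx.
(* If the middle entry is zero, the positive third entry decides the comparison; otherwise the
   middle entry decides it alone. *)
move: b_ge0; rewrite le_eqVlt => /orP[/eqP b0|b_gt0].
  exact: Or32.
exact: Or31.
Qed.

Theorem theorem3p1 (R : realType) (A B : tfn R)
    (hA : OT_positive A) (hB : OT_positive B) :
  OT_positive (tfn_add A B).
Proof.
have [bA cA] := proj1 (OT_positiveP _ _) hA.
have [bB cB] := proj1 (OT_positiveP _ _) hB.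
by apply/OT_positiveP; rewrite /= addr_ge0 // addr_gt0.
Qed.
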